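(* Let $I\subset(0,\infty)$ be an interval, let $f:I\to\mathbb{R}$ be differentiable on $I^{\circ}$, and let $a,b\in I$ with $a<b$, where $f'$ exists at every point of $[a,b]$ (one-sided derivative at $a$ or $b$ if that point is an endpoint of $I$), and $f'\in L[a,b]$. Let $q\ge 1$ and suppose $|f'|^q$ is harmonically convex on $[a,b]$. Then $$\left|\frac{f(a)+f(b)}{2}-\frac{ab}{b-a}\int_a^b\frac{f(x)}{x^2}\,dx\right|\le\frac{ab(b-a)}{2}\Big\{C_1(1;a,b)^{1-\frac1q}\big[C_2(1;a,b)|f'(a)|^q+C_3(1;a,b)|f'(b)|^q\big]^{\frac1q}$$ $$\qquad+C_1(1;b,a)^{1-\frac1q}\big[C_3(1;b,a)|f'(a)|^q+C_2(1;b,a)|f'(b)|^q\big]^{\frac1q}\Big\},$$ where, for $u,\vartheta>0$ with $u\ne\vartheta$, $$C_1(1;u,\vartheta)=\frac{1}{(\vartheta-u)^2}\left[\frac{\vartheta-u}{u}+2\ln\left(\frac{2u}{u+\vartheta}\right)\right],$$ $$C_2(1;u,\vartheta)=\frac{1}{(\vartheta-u)^3}\left[(3u+\vartheta)\ln\left(\frac{u+\vartheta}{2u}\right)-2(\vartheta-u)\right],$$ $$C_3(1;u,\vartheta)=\frac{1}{(\vartheta-u)^2}\left[\frac{u+\vartheta}{u}-\frac{u+3\vartheta}{\vartheta-u}\ln\left(\frac{u+\vartheta}{2u}\right)\right].$$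
   Context: A function $g:J\to\mathbb{R}$ on an interval $J\subset\mathbb{R}\setminus\{0\}$ is harmonically convex if $g\left(\frac{xy}{tx+(1-t)y}\right)\le t\,g(y)+(1-t)\,g(x)$ for all $x,y\in J$ and $t\in[0,1]$. $L[a,b]$ denotes the Lebesgue integrable functions on $[a,b]$. *)

(* Defs.v *)
From HB Require Import structures.
From mathcomp Require Import all_boot all_order all_algebra.
From mathcomp Require Import all_classical all_reals all_analysis.

Set Implicit Arguments.
Unset Strict Implicit.
Unset Printing Implicit Defensive.

Import Order.TTheory GRing.Theory Num.Theory.
Import numFieldNormedType.Exports.

Local Open Scope classical_set_scope.
Local Open Scope ring_scope.

(* Derivative of [f : I -> R]: as for the library's [derivable f x 1] and
   [derive1 f x], except that [h] is restricted to increments with [h + x] in [I].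
   It is the usual derivative at interior points of [I], the one-sided one at an
   endpoint belonging to [I], and ignores the values of [f] outside [I]. *)
Definition derivable_on (R : realType) (I : set R) (f : R -> R) (x : R) : Prop :=
  cvg (h^-1 * (f (h + x) - f x) @[h --> within [set h | I (h + x)] 0^']).

Definition derive_on (R : realType) (I : set R) (f : R -> R) (x : R) : R :=
  lim (h^-1 * (f (h + x) - f x) @[h --> within [set h | I (h + x)] 0^']).

Lemma within_dnbhs_interior (R : realType) (I : set R) (x : R) :
  I° x -> within [set h | I (h + x)] 0^' = (0 : R)^'.
Proof.
move=> Ix; have IN : \forall h \near (0 : R)^', I (h + x).
  apply: nbhs_dnbhs.
  have : h + x @[h --> (0 : R)] --> x.
    by rewrite -[X in _ --> X]add0r; apply: cvgD; [exact: cvg_id | exact: cvg_cst].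
  exact.
apply/seteqP; split => A /= AN; last exact: cvg_within AN.
by move: AN; rewrite /within /= => AN; near=> h; apply: (near AN h) => //=; near: h.
Unshelve. all: by end_near. Qed.

Lemma derivable_on_interior (R : realType) (I : set R) (f : R -> R) (x : R) :
  I° x -> derivable_on I f x <-> derivable f x 1.
Proof.
move=> Ix; rewrite /derivable_on within_dnbhs_interior // /derivable /=.
set d := (fun _ : R => _); set d' := (fun _ : R => _).
by suff -> : d = d' by []; apply/funext => h; rewrite /d /d' /= [h%:A]mulr1.
Qed.

Lemma derive_on_interior (R : realType) (I : set R) (f : R -> R) (x : R) :
  I° x -> derive_on I f x = derive1 f x.
Proof. by move=> Ix; rewrite /derive_on within_dnbhs_interior. Qed.

(* Meant for an interval [J] not containing [0]; the denominator, which lies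
   between [x] and [y], is then nonzero. *)
Definition harmonically_convex (R : realType) (J : set R) (g : R -> R) : Prop :=
  forall x y t : R, J x -> J y -> 0 <= t <= 1 ->
    g ((x * y) / (t * x + (1 - t) * y)) <= t * g y + (1 - t) * g x.

(* [C1 u v], [C2 u v], [C3 u v] are the coefficients C_i(1; u, v). *)
Definition C1 (R : realType) (u v : R) : R :=
  1 / (v - u) ^+ 2 * ((v - u) / u + 2 * ln (2 * u / (u + v))).

Definition C2 (R : realType) (u v : R) : R :=
  1 / (v - u) ^+ 3 *
  ((3 * u + v) * ln ((u + v) / (2 * u)) - 2 * (v - u)).

Definition C3 (R : realType) (u v : R) : R :=
  1 / (v - u) ^+ 2 *
  ((u + v) / u - (u + 3 * v) / (v - u) * ln ((u + v) / (2 * u))).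

(* Main.v *)
Require Import Defs.
From HB Require Import structures.
From mathcomp Require Import all_boot all_order all_algebra.
From mathcomp Require Import all_classical all_reals all_analysis.
From mathcomp Require Import ring lra.

Set Implicit Arguments.
Unset Strict Implicit.
Unset Printing Implicit Defensive.

Import Order.TTheory GRing.Theory Num.Theory.
Import numFieldNormedType.Exports.

Local Open Scope classical_set_scope.
Local Open Scope ring_scope.

(** Let [k x = ((a + b) - 2 a b / x) / (2 (b - a))], which vanishes at the harmonic
    mean [h = 2 a b / (a + b)], and
    [G x = k x * f x - a b / (b - a) * \int_a^x f t / t^2 dt].  Then [G' = k f'] and
    [G b - G a] is the quantity to be estimated.  On each of [[a, h]] and [[h, b]],
    harmonic convexity bounds [|f'|^q] by an affine function [Y] of [1 / x], and the
    tangent line of the concave function [y ^ (1 / q)] at the [|k|]-average of [Y]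
    bounds [|k f'|] by the derivative of an explicit combination of [x], [ln x] and
    [1 / x].  The mean value theorem then gives the estimate on each half; the
    choice of the tangency point replaces the power mean inequality. *)

(** * Two inequalities: tangent lines of powers, and mean values *)

(** After scaling to [m = 1], this is Young's inequality for [(y / m) ^ p] and [1] with exponents
    [1 / p] and [1 / (1 - p)]; [p = 1] is split off because the second exponent degenerates
    there. *)
Lemma powR_le_tangent (R : realType) (p m y : R) :
  0 < p <= 1 -> 0 < m -> 0 <= y -> y `^ p <= m `^ p * (1 - p + p * (y / m)).
Proof.
move=> /andP[p0 p1] m0 y0.
have ym0 : 0 <= y / m by rewrite divr_ge0// ltW.
have -> : y `^ p = m `^ p * (y / m) `^ p.
  by rewrite -powRM// ?ltW// mulrC divfK// gt_eqF.
rewrite ler_wpM2l ?powR_ge0//; move: p1; rewrite le_eqVlt => /predU1P[->|p1].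
  by rewrite powRr1// subrr add0r mul1r.
have q0 : 0 < 1 - p by rewrite subr_gt0.
have := @conjugate_powR R ((y / m) `^ p) 1 p^-1 (1 - p)^-1.
rewrite -powRrM divff ?gt_eqF// powRr1// powR1 !invrK mulr1 mul1r => H.
rewrite (le_trans (H _ _ _ _ _)) ?powR_ge0 ?invr_gt0//; first by rewrite addrC subrK.
by rewrite addrC mulrC.
Qed.

(** Both [P - F] and [P + F] have nonnegative derivatives. This takes the place of integrating
    [|F'| <= P']. *)
Lemma MVT_norm_le (R : realType) (F dF P dP : R -> R) (x y : R) : x < y ->
  (forall z, z \in `]x, y[ -> is_derive z 1 F (dF z)) ->
  {within `[x, y], continuous F} ->
  (forall z, z \in `]x, y[ -> is_derive z 1 P (dP z)) ->
  {within `[x, y], continuous P} ->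
  (forall z, z \in `]x, y[ -> `|dF z| <= dP z) ->
  `|F y - F x| <= P y - P x.
Proof.
move=> xy dF1 cF dP1 cP le_d.
have dB z : z \in `]x, y[ -> is_derive z 1 (P \- F) (dP z - dF z).
  by move=> zxy; apply: is_deriveB; [exact: dP1|exact: dF1].
have dD z : z \in `]x, y[ -> is_derive z 1 (P \+ F) (dP z + dF z).
  by move=> zxy; apply: is_deriveD; [exact: dP1|exact: dF1].
have [|c cxy /= cE] := MVT xy dB; first by move=> z; apply: cvgB; [exact: cP|exact: cF].
have [|e exy /= eE] := MVT xy dD; first by move=> z; apply: cvgD; [exact: cP|exact: cF].
have c0 : 0 <= (dP c - dF c) * (y - x).
  by rewrite mulr_ge0 ?subr_ge0 ?(ltW xy)// (le_trans (ler_norm _))// le_d.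
have e0 : 0 <= (dP e + dF e) * (y - x).
  rewrite mulr_ge0 ?subr_ge0 ?(ltW xy)// addrC -[dF e]opprK addrC subr_ge0.
  by rewrite (le_trans (ler_norm _))// normrN le_d.
by rewrite ler_norml; apply/andP; split; lra.
Qed.

(** * Explicit primitives and the coefficients *)

(** A product of two affine functions of [1 / x] has a primitive of this form. *)
Definition inv_ln_comb (R : realType) (k l m x : R) := k * x + l * ln x + m / x.

Lemma is_derive_inv_ln_comb (R : realType) (k l m x : R) : 0 < x ->
  is_derive x 1 (inv_ln_comb k l m) (k + l / x - m / x ^+ 2).
Proof.
move=> x0; have dln := is_derive1_ln x0.
have xn0 : id x != 0 by rewrite gt_eqF.
have dV := is_deriveV xn0 (is_derive_id x 1).
have -> : inv_ln_comb k l m = k \*: id + l \*: (@ln R) + m \*: (fun y => (id y)^-1).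
  by apply/funext => y; rewrite /inv_ln_comb.
apply: is_derive_eq.
rewrite /= /GRing.scale/=; field; exact: xn0.
Qed.

(* Primitive of [(1 - 2 t) (t A + (1 - t) B)], where [t = harm_weight u v x]. *)
Definition kernel_primitive (R : realType) (u v A B : R) : R -> R :=
  inv_ln_comb ((u + v) * (v * B - u * A) / (v - u) ^+ 2)
    (u * v * ((3 * u + v) * A - (u + 3 * v) * B) / (v - u) ^+ 2)
    (2 * (u * v) ^+ 2 * (A - B) / (v - u) ^+ 2).

(* The weight [t] for which [x = u v / (t v + (1 - t) u)]. *)
Definition harm_weight (R : realType) (u v x : R) := (u * v / x - u) / (v - u).

Lemma is_derive_kernel_primitive (R : realType) (u v A B x : R) : u != v -> 0 < x ->
  let t := harm_weight u v x in
  is_derive x 1 (kernel_primitive u v A B)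
    ((1 - 2 * t) * (t * A + (1 - t) * B)).
Proof.
move=> uv x0 /=; have xn0 : x != 0 by rewrite gt_eqF.
have vu0 : v - u != 0 by rewrite subr_eq0 eq_sym.
have := is_derive_inv_ln_comb ((u + v) * (v * B - u * A) / (v - u) ^+ 2)
    (u * v * ((3 * u + v) * A - (u + 3 * v) * B) / (v - u) ^+ 2)
    (2 * (u * v) ^+ 2 * (A - B) / (v - u) ^+ 2) x0.
move/is_derive_eq; apply; rewrite /harm_weight; field.
by rewrite xn0 vu0.
Qed.

(** Origin of [C2] and [C3]: the harmonic weight [t] is [1/2] at the harmonic mean and [0] at [v],
    and up to the factor [u v (v - u)] they are the integrals of [(1 - 2 t) t] and
    [(1 - 2 t) (1 - t)] between these points. *)
Lemma kernel_primitive_sub (R : realType) (u v A B : R) : 0 < u -> 0 < v -> u != v ->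
  kernel_primitive u v A B v - kernel_primitive u v A B (2 * u * v / (u + v))
  = u * v * (v - u) * (C2 u v * A + C3 u v * B).
Proof.
move=> u0 v0 uv.
have vu0 : v - u != 0 by rewrite subr_eq0 eq_sym.
have uv0 : 0 < u + v by rewrite addr_gt0.
rewrite /kernel_primitive /inv_ln_comb /C2 /C3.
have -> : ln (2 * u * v / (u + v)) = ln v - ln ((u + v) / (2 * u)).
  rewrite -ln_div ?posrE ?divr_gt0 ?mulr_gt0//; congr ln; field.
  by rewrite !gt_eqF.
field.
by rewrite vu0 !gt_eqF.
Qed.

(** Since [t + (1 - t) = 1], [C1] corresponds to the integral of [1 - 2 t], the total mass of the
    kernel. *)
Lemma C1E (R : realType) (u v : R) : 0 < u -> 0 < v -> u != v ->
  C1 u v = C2 u v + C3 u v.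
Proof.
move=> u0 v0 uv.
have vu0 : v - u != 0 by rewrite subr_eq0 eq_sym.
have uv0 : 0 < u + v by rewrite addr_gt0.
have -> : C1 u v = 1 / (v - u) ^+ 2 * ((v - u) / u - 2 * ln ((u + v) / (2 * u))).
  rewrite /C1 -mulrN -lnV ?posrE ?divr_gt0 ?mulr_gt0//.
  by rewrite invf_div.
rewrite /C2 /C3; field.
by rewrite vu0 gt_eqF.
Qed.

(** * The estimate on one half of the interval *)

Lemma derive_within_continuous (R : realType) (F dF : R -> R) (a b : R) :
  (forall x, a <= x <= b -> is_derive x 1 F (dF x)) ->
  {within `[a, b], continuous F}.
Proof.
move=> dF1; apply: derivable_within_continuous => x; rewrite in_itv/= => /dF1 dFx.
exact: ex_derive.
Qed.

(* [[lo, hi]] is the interval between [v] and the harmonic mean of [u] and [v];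
   both orders of [u] and [v] occur, one for each half of [[a, b]]. *)
Section half_interval.
Variables (R : realType) (u v lo hi : R).
Hypotheses (u0 : 0 < u) (v0 : 0 < v) (uv : u != v).
Hypothesis lohi : (lo, hi) = if u < v then (2 * u * v / (u + v), v)
                             else (v, 2 * u * v / (u + v)).

Let vu0 : v - u != 0. Proof. by rewrite subr_eq0 eq_sym. Qed.
Let uvp : 0 < u + v. Proof. by rewrite addr_gt0. Qed.

Lemma half_bounds : 0 < lo < hi.
Proof.
case: ltP lohi => [ltuv|leuv] [-> ->].
  by rewrite divr_gt0 ?mulr_gt0//= ltr_pdivrMr// [ltLHS]mulrC ltr_pM2l//; lra.
have ltvu : v < u by rewrite lt_neqAle eq_sym uv.
by rewrite v0/= ltr_pdivlMr// [ltRHS]mulrC ltr_pM2l//; lra.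
Qed.

Lemma harm_weight_half x : lo < x < hi -> 0 < harm_weight u v x < 1 / 2.
Proof.
move=> /andP[lox xhi].
have x0 : 0 < x by case/andP: half_bounds => l0 _; exact: lt_trans lox.
have sx : u * v / x * x = u * v by rewrite divfK// gt_eqF.
(* Quotients are kept only through the products [s x] and [t (v - u)], which leaves linear
   arithmetic in each case. *)
rewrite /harm_weight; move: (u * v / x) sx => s sx.
have tE : (s - u) / (v - u) * (v - u) = s - u by rewrite divfK.
move: ((s - u) / _) tE => t tE.
case: ltP lohi => [ltuv|leuv] [loE hiE]; rewrite {}loE {}hiE in lox xhi.
  rewrite ltr_pdivrMr// in lox.
  have us : u < s by rewrite -(ltr_pM2r x0) sx ltr_pM2l.
  have s2 : s < (u + v) / 2 by rewrite -(ltr_pM2r x0) sx; lra.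
  have d0 : 0 < v - u by rewrite subr_gt0.
  by rewrite -(pmulr_lgt0 t d0) -(ltr_pM2r d0 t) tE subr_gt0 us/=; lra.
have ltvu : v < u by rewrite lt_neqAle eq_sym uv.
rewrite ltr_pdivlMr// in xhi.
have us : s < u by rewrite -(ltr_pM2r x0) sx ltr_pM2l.
have s2 : (u + v) / 2 < s by rewrite -(ltr_pM2r x0) sx; lra.
have d0 : 0 < u - v by rewrite subr_gt0.
have {}tE : t * (u - v) = u - s by rewrite -opprB mulrN tE opprB.
by rewrite -(pmulr_lgt0 t d0) -(ltr_pM2r d0 t) tE subr_gt0 us/=; lra.
Qed.

Lemma kernel_primitive_half A B :
  kernel_primitive u v A B hi - kernel_primitive u v A B lo
  = u * v * `|v - u| * (C2 u v * A + C3 u v * B).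
Proof.
have := kernel_primitive_sub A B u0 v0 uv.
case: ltP lohi => [ltuv|leuv] [-> ->] E.
  by rewrite E gtr0_norm ?subr_gt0.
by rewrite -opprB E ler0_norm ?subr_le0// mulrN mulNr.
Qed.

Let derP A B x : lo <= x <= hi ->
  is_derive x 1 (kernel_primitive u v A B)
    ((1 - 2 * harm_weight u v x)
     * (harm_weight u v x * A + (1 - harm_weight u v x) * B)).
Proof.
move=> /andP[lox _]; apply: is_derive_kernel_primitive => //.
by case/andP: half_bounds => l0 _; exact: lt_le_trans lox.
Qed.

Let contP A B : {within `[lo, hi], continuous (kernel_primitive u v A B)}.
Proof. exact: derive_within_continuous (@derP A B). Qed.

Let derP_oo A B x : x \in `]lo, hi[ ->
  is_derive x 1 (kernel_primitive u v A B)
    ((1 - 2 * harm_weight u v x)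
     * (harm_weight u v x * A + (1 - harm_weight u v x) * B)).
Proof.
by rewrite in_itv/= => /andP[lox xhi]; apply: derP; rewrite !ltW.
Qed.

(** The mean value theorem turns the combination, up to positive factors, into a value of
    [(1 - 2 t) (t A + (1 - t) B)] with [0 < t < 1/2], so the signs of the logarithmic formulas need
    no study. *)
Lemma C2_C3_comb_gt0 A B : 0 <= A -> 0 <= B -> (0 < A) || (0 < B) ->
  0 < C2 u v * A + C3 u v * B.
Proof.
move=> A0 B0 AB; have /andP[l0 lh] := half_bounds.
have [c] := MVT lh (@derP_oo A B) (@contP A B).
rewrite in_itv/= => /harm_weight_half /andP[t0 t2].
rewrite kernel_primitive_half => E.
have d0 : 0 < u * v * `|v - u| by rewrite !mulr_gt0// normr_gt0.
rewrite -(pmulr_rgt0 _ d0) E !mulr_gt0 ?subr_gt0//; first lra.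
case/orP: AB => ?; first by apply: ltr_wpDr; nra.
by apply: ltr_wpDl; nra.
Qed.

Lemma C1_gt0 : 0 < C1 u v.
Proof.
by rewrite C1E//; have := C2_C3_comb_gt0 ler01 ler01; rewrite ltr01 !mulr1; exact.
Qed.

Lemma half_interval_bound (p A B : R) (G dG : R -> R) :
  0 < p <= 1 -> 0 <= A -> 0 <= B ->
  (forall x, x \in `]lo, hi[ -> is_derive x 1 G (dG x)) ->
  {within `[lo, hi], continuous G} ->
  (forall x, x \in `]lo, hi[ -> let t := harm_weight u v x in
    `|dG x| <= (1 - 2 * t) / 2 * (t * A + (1 - t) * B) `^ p) ->
  `|G hi - G lo| <= u * v * `|v - u| / 2
    * (C1 u v `^ (1 - p) * (C2 u v * A + C3 u v * B) `^ p).
Proof.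
move=> p01 A0 B0 dG1 cG le_dG; have /andP[p0 p1] := p01.
have /andP[l0 lh] := half_bounds.
have C10 := C1_gt0.
have [AB|] := boolP ((0 < A) || (0 < B)); last first.
  (* For [A = B = 0] the tangency point would be [0]; here the derivative of [G] vanishes
     instead. *)
  rewrite negb_or -!leNgt => /andP[A0' B0'].
  have {}A0 : A = 0 by apply/le_anti; rewrite A0 A0'.
  have {}B0 : B = 0 by apply/le_anti; rewrite B0 B0'.
  subst A B.
  rewrite (le_trans (MVT_norm_le lh dG1 cG (@derP_oo 0 0) (@contP 0 0) _))//.
    move=> x /le_dG /le_trans; apply.
    by rewrite !mulr0 addr0 powR0 ?mulr0// gt_eqF.
  rewrite kernel_primitive_half !mulr0 addr0 mulr0.
  by rewrite !mulr_ge0 ?powR_ge0 ?normr_ge0 ?invr_ge0 ?(ltW u0) ?(ltW v0).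
have S0 := C2_C3_comb_gt0 A0 B0 AB.
(* [m] is the average of [t A + (1 - t) B] for the weight [1 - 2 t]. *)
set S := C2 u v * A + C3 u v * B in S0 *; set m := S / C1 u v.
have m0 : 0 < m by rewrite divr_gt0.
pose tangent Y := m `^ p / 2 * (1 - p + p * (Y / m)).
rewrite (le_trans (MVT_norm_le lh dG1 cG (@derP_oo (tangent A) (tangent B))
  (@contP _ _) _))//.
  move=> x xlh; apply: (le_trans (le_dG _ xlh)).
  have /harm_weight_half/andP[t0 t2] : lo < x < hi by move: xlh; rewrite in_itv.
  move: (harm_weight u v x) t0 t2 => t t0 t2 /=.
  have Y0 : 0 <= t * A + (1 - t) * B.
    by rewrite addr_ge0 ?mulr_ge0 ?subr_ge0 ?(ltW t0)//; lra.
  (* [tangent] is affine, so the majorant is again a kernel integrand, with [tangent A] and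
     [tangent B] as data. *)
  have -> : t * tangent A + (1 - t) * tangent B = tangent (t * A + (1 - t) * B).
    by rewrite /tangent; field; rewrite gt_eqF.
  rewrite -mulrA ler_wpM2l ?subr_ge0//; first lra.
  by rewrite /tangent mulrAC [2^-1 * _]mulrC ler_pM2r ?invr_gt0//; exact: powR_le_tangent.
rewrite kernel_primitive_half.
(* As [S / m = C1], the shares [1 - p] and [p] of [C1] add up to all of it. *)
have -> : C2 u v * tangent A + C3 u v * tangent B = C1 u v * m `^ p / 2.
  have -> : C1 u v * m `^ p / 2 = C1 u v * (1 - p) * m `^ p / 2 + p * S * m `^ p / 2 / m.
    by rewrite /m; field; rewrite !gt_eqF.
  by rewrite C1E// /tangent /S; field; rewrite gt_eqF.
have -> : S = C1 u v * m by rewrite /m mulrC divfK ?gt_eqF.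
rewrite powRM ?(ltW C10) ?(ltW m0)// [C1 u v `^ _ * _]mulrA -powRD; last first.
  by rewrite (gt_eqF C10) implybT.
rewrite subrK powRr1 ?(ltW C10)//.
rewrite [leLHS](_ : _ = u * v * `|v - u| / 2 * (C1 u v * m `^ p))//.
by field.
Qed.

End half_interval.

(** * Relative derivatives, continuity and interior points *)

(** Along admissible increments, [f (h + x)] is [h] times the difference quotient plus [f x]. The
    limit is then transported by [h = y - x], with [y = x] treated apart since the filter is
    punctured. *)
Lemma derivable_on_continuous (R : realType) (I J : set R) (f : R -> R) :
  J `<=` I -> (forall x, J x -> derivable_on I f x) -> {within J, continuous f}.
Proof.
move=> JI df; apply/subspace_continuousP => x /df /cvg_ex[l fl] A fxA.
have h0 : (h : R) @[h --> within [set h | I (h + x)] 0^'] --> (0 : R).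
  by apply: cvg_within_filter; exact: nbhs_dnbhs.
have : f (h + x) @[h --> within [set h | I (h + x)] 0^'] --> f x.
  rewrite [X in _ --> X](_ : _ = 0 * l + f x); last by rewrite mul0r add0r.
  apply: cvg_trans (cvgD (cvgM h0 fl) (cvg_cst (f x))).
  apply: near_eq_cvg; rewrite near_withinE.
  near=> h => _; rewrite fctE /cst /= mulrA divff ?mul1r ?subrK//.
  near: h; exact: nbhs_dnbhs_neq.
move=> /(_ A fxA); rewrite /= /within /dnbhs /= => H.
have yx : y - x @[y --> x] --> (0 : R).
  by rewrite -(subrr x); apply: cvgB; [exact: cvg_id|exact: cvg_cst].
have H' : \forall y \near x, y - x != 0 -> I (y - x + x) -> A (f (y - x + x)).
  exact: yx _ H.
suff : \forall y \near x, J y -> A (f y) by [].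
apply: filterS H' => y H' Jy.
have [->|yxn] := eqVneq y x; first exact: nbhs_singleton.
by rewrite -(subrK x y); apply: H'; rewrite ?subr_eq0// subrK; exact: JI.
Unshelve. all: by end_near. Qed.

Lemma interior_oo_interval (R : realType) (I : set R) (a b : R) :
  is_interval I -> I a -> I b -> `]a, b[ `<=` I°.
Proof.
move=> I_itv Ia Ib; rewrite -open_subsetE; last exact: interval_open.
move=> x /=; rewrite in_itv/= => /andP[ax xb].
by apply: (I_itv a b) => //; rewrite !ltW.
Qed.

(** * Assembling the two halves *)

Theorem corollary2 (R : realType) (I : set R) (f : R -> R) (a b q : R)
  (I_itv : is_interval I) (I_pos : I `<=` [set x | 0 < x])
  (f_diff : forall x, I° x -> derivable f x 1)
  (Ia : I a) (Ib : I b) (ab : a < b)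
  (f_diff_ab : forall x, `[a, b]%classic x -> derivable_on I f x)
  (f'_int : (@lebesgue_measure R).-integrable `[a, b]%classic
              (fun x => (derive_on I f x)%:E))
  (q1 : 1 <= q)
  (f'_hconv : harmonically_convex `[a, b]%classic
                (fun x => `|derive_on I f x| `^ q)) :
  `| (f a + f b) / 2
     - a * b / (b - a) *
       \int[@lebesgue_measure R]_(x in `[a, b]%classic) (f x / x ^+ 2) |
  <= a * b * (b - a) / 2 *
     (C1 a b `^ (1 - 1 / q) *
        (C2 a b * `|derive_on I f a| `^ q
         + C3 a b * `|derive_on I f b| `^ q) `^ (1 / q)
      + C1 b a `^ (1 - 1 / q) *
        (C3 b a * `|derive_on I f a| `^ q
         + C2 b a * `|derive_on I f b| `^ q) `^ (1 / q)).
Proof.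
have a0 : 0 < a := I_pos _ Ia; have b0 : 0 < b := I_pos _ Ib.
have ba0 : b - a != 0 by rewrite subr_eq0 gt_eqF.
have abI : `[a, b] `<=` I.
  by move=> x /=; rewrite in_itv/= => /(I_itv a b); exact.
have pos (x : R) : x \in `[a, b] -> 0 < x by move=> xab; exact/I_pos/abI.
have cf : {within `[a, b], continuous f} := derivable_on_continuous abI f_diff_ab.
have dV (x : R) : 0 < x -> is_derive x 1 (fun y : R => y^-1) (- x ^- 2).
  move=> x0; have xn0 : id x != 0 by rewrite gt_eqF.
  apply: is_derive_eq (is_deriveV xn0 (is_derive_id x 1)) _.
  exact: mulr1.
have cV : {within `[a, b], continuous (fun y : R => y^-1)}.
  apply: (@derive_within_continuous _ _ (fun x => - x ^- 2)) => x xab.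
  by apply: dV; apply: pos; rewrite in_itv.
pose g x := f x / x ^+ 2.
have cg : {within `[a, b], continuous g}.
  have -> : g = (fun x => f x * (x^-1 * x^-1)).
    by apply/funext => x; rewrite /g expr2 invfM.
  by move=> x; apply: cvgM; [exact: cf|apply: cvgM; exact: cV].
have ig : lebesgue_measure.-integrable `[a, b] (EFin \o g).
  by apply: continuous_compact_integrable => //; exact: segment_compact.
pose J x := parameterized_integral lebesgue_measure a x g.
have cJ : {within `[a, b], continuous J}.
  exact: parameterized_integral_continuous (ltW ab) ig.
have dJ x : x \in `]a, b[ -> is_derive x 1 J (g x).
  move=> xab; have /andP[ax xb] : a < x < b by move: xab; rewrite in_itv.
  have /(continuous_within_itvP _ ab)[/(_ x xab) cgx _ _] := cg.
  have [dJx <-] := continuous_FTC1_closed xb ig ax cgx.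
  by rewrite derive1E; exact: derivableP.
have df x : x \in `]a, b[ -> is_derive x 1 f (derive_on I f x).
  move=> xab; have Ix : I° x by exact: interior_oo_interval xab.
  by rewrite derive_on_interior// derive1E; apply: derivableP; exact: f_diff.
pose k x := (a + b) / (2 * (b - a)) - a * b / (b - a) * x^-1.
pose G x := k x * f x - a * b / (b - a) * J x.
have ck : {within `[a, b], continuous k}.
  by move=> x; apply: cvgB; [exact: cvg_cst|apply: cvgM; [exact: cvg_cst|exact: cV]].
have cG : {within `[a, b], continuous G}.
  move=> x; apply: cvgB; first by apply: cvgM; [exact: ck|exact: cf].
  by apply: cvgM; [exact: cvg_cst|exact: cJ].
(* Integration by parts: [k' f] cancels the derivative of the integral term. *)
have dG x : x \in `]a, b[ -> is_derive x 1 G (k x * derive_on I f x).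
  move=> xab; have x0 : 0 < x by apply: pos; exact: subset_itv_oo_cc xab.
  have dVx := dV _ x0; have dfx := df _ xab; have dJx := dJ _ xab.
  have -> : G = (cst ((a + b) / (2 * (b - a))) - a * b / (b - a) \*: (fun y => y^-1)) * f
              - a * b / (b - a) \*: J by [].
  apply: is_derive_eq; rewrite !fctE /= /GRing.scale/= /k /g.
  by field; rewrite ba0 gt_eqF.
have GabE : G b - G a = (f a + f b) / 2
    - a * b / (b - a) * \int[@lebesgue_measure R]_(x in `[a, b]) g x.
  (* The constants in [k] make [k b = 1/2] and [k a = -1/2]. *)
  have -> : G b = f b / 2
      - a * b / (b - a) * \int[@lebesgue_measure R]_(x in `[a, b]) g x.
    congr (_ - _); rewrite /k mulrC; congr (_ * _); field.
    by rewrite ba0 gt_eqF.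
  have -> : G a = - f a / 2.
    rewrite /G /J /parameterized_integral set_itv1 Rintegral_set1 mulr0 subr0 /k.
    field; by rewrite ba0 gt_eqF.
  by field.
pose h := 2 * a * b / (a + b).
have q0 : 0 < q by rewrite (lt_le_trans _ q1).
have p01 : 0 < 1 / q <= 1 by rewrite div1r invr_gt0 q0 invf_le1.
have ahb : a < h < b.
  by rewrite ltr_pdivlMr ?ltr_pdivrMr ?addr_gt0//; apply/andP; split; nra.
have /andP[ah hb] := ahb.
have le_df (x t : R) : 0 <= t <= 1 -> x * (t * b + (1 - t) * a) = a * b ->
    `|derive_on I f x| <= (t * `|derive_on I f a| `^ q
                           + (1 - t) * `|derive_on I f b| `^ q) `^ (1 / q).
  move=> t01 xE; have tab : 0 < t * b + (1 - t) * a by nra.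
  have : x = b * a / (t * b + (1 - t) * a).
    by rewrite [b * a]mulrC -xE mulfK// gt_eqF.
  (* Taking the points in the order [b], [a] puts the weight [t] on the value at [a]. *)
  have /(_ b a t) := f'_hconv.
  rewrite /= !in_itv/= !lexx (ltW ab) => /(_ isT isT t01) + ->.
  move=> /(ge0_ler_powR (ltW (proj1 (andP p01)))).
  rewrite -powRrM [q * _](_ : _ = 1) ?powRr1//; last by field; rewrite gt_eqF.
  apply.
  - exact: powR_ge0.
  - by rewrite nnegrE addr_ge0// mulr_ge0 ?powR_ge0//; lra.
have hE : h = 2 * b * a / (b + a) by rewrite /h [2 * a * b]mulrAC [a + b]addrC.
have dG_le (x t : R) : x \in `]a, b[ -> 0 <= t <= 1 ->
    x * (t * b + (1 - t) * a) = a * b ->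
    `|k x * derive_on I f x| <= `|1 - 2 * t| / 2 *
      (t * `|derive_on I f a| `^ q + (1 - t) * `|derive_on I f b| `^ q) `^ (1 / q).
  move=> xab t01 xE; have x0 : 0 < x by apply: pos; exact: subset_itv_oo_cc xab.
  have -> : k x = (1 - 2 * t) / 2.
    by rewrite /k -xE; field; rewrite ba0 gt_eqF.
  by rewrite !normrM [`|2^-1|]gtr0_norm// ler_wpM2l ?le_df// divr_ge0.
have subG (c d : R) : a <= c -> d <= b -> {within `[c, d], continuous G}.
  by move=> ac db; apply: continuous_subspaceW cG; exact: subset_itvScc.
rewrite -GabE; clearbody k G J g.
move: (`|derive_on I f a| `^ q) (powR_ge0 `|derive_on I f a| q)
  (`|derive_on I f b| `^ q) (powR_ge0 `|derive_on I f b| q) dG_le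
  => A A0 B B0 dG_le.
have nab : a != b by rewrite lt_eqF.
have nba : b != a by rewrite eq_sym.
have ab0 : a - b != 0 by rewrite subr_eq0.
(* The right half is the case [(u, v) = (a, b)], the left half [(u, v) = (b, a)]; hence the two
   orders of arguments in the coefficients. *)
have lohi_r : (h, b) = if a < b then (2 * a * b / (a + b), b)
                       else (b, 2 * a * b / (a + b)) by rewrite ab.
have lohi_l : (a, h) = if b < a then (2 * b * a / (b + a), a)
                       else (a, 2 * b * a / (b + a)) by rewrite hE ltNge (ltW ab).
have sub_r (x : R) : x \in `]h, b[ -> x \in `]a, b[.
  by rewrite !in_itv/= => /andP[hx ->]; rewrite (lt_trans ah).
have sub_l (x : R) : x \in `]a, h[ -> x \in `]a, b[.
  by rewrite !in_itv/= => /andP[-> xh]; rewrite (lt_trans xh).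
have dG_le_r (x : R) : x \in `]h, b[ -> let t := harm_weight a b x in
    `|k x * derive_on I f x| <= (1 - 2 * t) / 2 * (t * A + (1 - t) * B) `^ (1 / q).
  move=> xhb /=; have xab := sub_r _ xhb; set t := harm_weight a b x.
  have x0 : 0 < x by apply: pos; exact: subset_itv_oo_cc xab.
  have : 0 < t < 1 / 2.
    by apply: (harm_weight_half a0 b0 nab lohi_r); move: xhb; rewrite in_itv.
  have : x * (t * b + (1 - t) * a) = a * b.
    by rewrite /t /harm_weight; field; rewrite ba0 gt_eqF.
  move: t => t tE /andP[t0 t2].
  rewrite -[X in X / 2]ger0_norm; last lra.
  by apply: dG_le => //; lra.
have dG_le_l (x : R) : x \in `]a, h[ -> let t := harm_weight b a x in
    `|k x * derive_on I f x| <= (1 - 2 * t) / 2 * (t * B + (1 - t) * A) `^ (1 / q).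
  move=> xah /=; have xab := sub_l _ xah; set t := harm_weight b a x.
  have x0 : 0 < x by apply: pos; exact: subset_itv_oo_cc xab.
  have : 0 < t < 1 / 2.
    by apply: (harm_weight_half b0 a0 nba lohi_l); move: xah; rewrite in_itv.
  (* With [u] and [v] exchanged, [t] is the weight of [B], so the bound is used at [1 - t]; [k] is
     negative on this half. *)
  have : x * ((1 - t) * b + (1 - (1 - t)) * a) = a * b.
    by rewrite /t /harm_weight; field; rewrite ab0 gt_eqF.
  move: t => t tE /andP[t0 t2].
  have t01 : 0 <= 1 - t <= 1 by lra.
  have := dG_le _ _ xab t01 tE.
  have -> : `|1 - 2 * (1 - t)| = 1 - 2 * t by rewrite ler0_norm; [ring|lra].
  by rewrite subKr (addrC ((1 - t) * A)).
have dG_r (x : R) (xhb : x \in `]h, b[) := dG x (sub_r x xhb).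
have dG_l (x : R) (xah : x \in `]a, h[) := dG x (sub_l x xah).
have cG_r := subG h b (ltW ah) (lexx b).
have cG_l := subG a h (lexx a) (ltW hb).
have right_half := half_interval_bound a0 b0 nab lohi_r p01 A0 B0 dG_r cG_r dG_le_r.
have left_half := half_interval_bound b0 a0 nba lohi_l p01 B0 A0 dG_l cG_l dG_le_l.
have baE : `|b - a| = b - a by rewrite gtr0_norm ?subr_gt0.
rewrite baE in right_half; rewrite [`|a - b|]distrC baE in left_half.
rewrite [b * a]mulrC [C2 b a * _ + _]addrC in left_half.
apply: le_trans (ler_distD (G h) _ _) _.
rewrite mulrDr; exact: lerD right_half left_half.
Qed.
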